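(* Consider an independent multi-urn search problem. A block policy $\mathbf u_B=(v^1,v^2,\dots,v^{|\mathcal V|})$ is optimal if and only if $$N_{v^i}\left(\frac{2-\varphi_{v^i}}{\varphi_{v^i}}\right)\le N_{v^{i+1}}\left(\frac{2-\varphi_{v^{i+1}}}{\varphi_{v^{i+1}}}\right),\qquad i=1,2,\dots,|\mathcal V|-1.$$
   Context: Multi-urn search problem. Let $\mathcal V$ be a finite nonempty set of urns. Urn $i\in\mathcal V$ contains $N_i\ge 1$ marbles ($N_i$ a known integer), at most one of which is red; all other marbles are blue. Let $A_i$ be the event that urn $i$ contains a red marble. For $U\subseteq\mathcal V$ put $\varphi_U=\mathbb P(\bigcap_{i\in U}A_i)$, with $\varphi_\emptyset=1$ and $\varphi_i=\varphi_{\{i\}}$; it is assumed that $\varphi_i>0$ for all $i$. Marbles are drawn from each urn in uniformly random order without replacement: given which urns contain a red marble, the position of the red marble in the draw order of each such urn $i$ is uniform on $\{1,\dots,N_i\}$, and these positions are independent across urns. The problem is independent if $\varphi_U=\prod_{i\in U}\varphi_i$ for every $U\subseteq\mathcal V$. Let $N=\sum_{i\in\mathcal V}N_i$. A valid policy is a sequence $\mathbf u=(u(0),\dots,u(N-1))$ of elements of $\mathcal V$ with $|\{t:u(t)=i\}|=N_i$ for every $i\in\mathcal V$. The search following $\mathbf u$ draws, at each stage $t=0,1,\dots$, one marble from urn $u(t)$, discards it if it is blue, and stops as soon as a red marble is drawn or all urns are empty. The cost $C\in\{0,1,\dots,N\}$ is the number of blue marbles drawn in the search (so $C=N$ if there is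 no red marble). A valid policy is optimal if it minimizes $\mathbb E[C]$ over all valid policies. A block policy, written $\mathbf u_B=(v^1,\dots,v^{|\mathcal V|})$ with $(v^1,\dots,v^{|\mathcal V|})$ an ordering of the urns in $\mathcal V$, is the valid policy in which each urn is queried exhaustively before the next one: $u(t)=v^i$ whenever $\sum_{j=1}^{i-1}N_{v^j}\le t<\sum_{j=1}^{i}N_{v^j}$.
   Formalization: The ''only if'' direction additionally assumes φ_{v^i} < 1 for every urn followed by at least two others in the block order; as stated it is false, since urns placed after one with φ = 1 are never queried and can be reordered freely. The ''if'' direction is unchanged. *)

(* Defs.v *)
From HB Require Import structures.
From mathcomp Require Import all_boot all_order all_algebra.
From mathcomp Require Import all_classical all_reals all_analysis.

Set Implicit Arguments.
Unset Strict Implicit.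
Unset Printing Implicit Defensive.

Import Order.TTheory GRing.Theory Num.Theory.

Local Open Scope classical_set_scope.
Local Open Scope ring_scope.

Section MultiUrn.
Context {d : measure_display} {T : measurableType d} {R : realType}.
Context (P : probability T R) {V : finType}.

(* [red i] is the event A_i that urn i contains a red marble, [pos i] the
   position of that marble in the draw order of urn i, counted from 1; the
   values of [pos i] outside [red i] are irrelevant and unconstrained. *)
Definition exactly_red (red : V -> set T) (U : {set V}) : set T :=
  [set w | forall i, red i w <-> i \in U].

(* [pos_law] is the conditional law of the positions given the set U of urns
   containing a red marble, multiplied by the probability of the conditioning
   event, so that it also makes sense when the latter is null. *)
Record urn_problem := UrnProblem {
  urn_size : V -> nat;
  red : V -> set T;
  pos : V -> T -> nat;
  urn_size_gt0 : forall i, (0 < urn_size i)%N;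
  measurable_red : forall i, measurable (red i);
  measurable_pos : forall i, measurable_fun (red i) (pos i);
  red_gt0 : forall i, (0 < P (red i))%E;
  pos_range : forall i w, red i w -> (1 <= pos i w <= urn_size i)%N;
  pos_law : forall (U : {set V}) (k : V -> nat),
    (forall i, i \in U -> (1 <= k i <= urn_size i)%N) ->
    P [set w | exactly_red red U w /\ forall i, i \in U -> pos i w = k i] =
    (P (exactly_red red U) * (\prod_(i in U) (urn_size i)%:R^-1)%:E)%E
}.

Implicit Types (S : urn_problem) (u v : seq V) (w : T).

Definition phi S (U : {set V}) : R := fine (P (\bigcap_(i in [set` U]) red S i)).

Definition independent_urns S : Prop :=
  forall U : {set V}, phi S U = \prod_(i in U) phi S [set i].

Definition valid_policy S u : Prop :=
  size u = (\sum_i urn_size S i)%N /\ forall i, count_mem i u = urn_size S i.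

Definition urn_at u (t : 'I_(size u)) : V := tnth (in_tuple u) t.

(* Stage t is the [count_mem i (take t.+1 u)]-th draw from urn i = u(t). *)
Definition red_at S u w (t : 'I_(size u)) : bool :=
  let i := urn_at t in
  `[< red S i w >] && (pos S i w == count_mem i (take t.+1 u)).

(* The search reaches stage t and draws a blue marble there. *)
Definition blue_drawn S u w (t : 'I_(size u)) : bool :=
  [forall s : 'I_(size u), (s <= t)%N ==> ~~ red_at S w s].

Definition cost S u w : nat := #|[pred t : 'I_(size u) | blue_drawn S w t]|.

Definition expected_cost S u : \bar R := 'E_P[fun w => (cost S u w)%:R]%E.

Definition optimal S u : Prop :=
  valid_policy S u /\
  forall u', valid_policy S u' -> (expected_cost S u <= expected_cost S u')%E.

Definition urn_ordering v : Prop := perm_eq v (enum V).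

Definition block_policy S v : seq V :=
  flatten [seq nseq (urn_size S i) i | i <- v].

Definition urn_index S (i : V) : R :=
  (urn_size S i)%:R * ((2 - phi S [set i]) / phi S [set i]).

End MultiUrn.

(* Main.v *)
Require Import Defs.
From HB Require Import structures.
From mathcomp Require Import all_boot all_order all_algebra.
From mathcomp Require Import all_classical all_reals all_analysis.
From mathcomp Require Import zify ring lra.

(** Why the theorem holds.

    Write p_i for the probability that urn i contains a red marble. Since the
    position of a red marble is uniform, c draws from urn i are all blue with
    probability g_i(c) = 1 - p_i c / N_i, and since the urns are independent
    the search outlives the history h with probability prod_i g_i(c_i(h)),
    where c_i(h) counts the draws from urn i in h. The expected cost of a
    policy is the sum of these products over its nonempty prefixes
    ([expected_costE]): the problem becomes one about words over V with
    prescribed letter counts.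

    What matters about g_i is that it is affine and decreasing. Let a word
    contain two consecutive runs of urn i, A then C, with a word B avoiding i
    between them. The runs can be merged by
    moving A past B or by moving C before B. If both moves increased the cost,
    then B would be strictly worse than A and strictly better than C per unit of
    probability of ending the search; but each draw from urn i lowers g_i by the
    same amount p_i / N_i and costs the value it leaves, which only gets
    smaller, so C is at least as good as A. Hence one of the two moves is
    harmless ([merge_runs]), and repeating it turns any policy into a block
    policy that costs no more ([exists_block_policy_le]).

    Finally, exhausting urn i costs L_i = sum_(1 <= k <= N_i) g_i(k) and ends
    the search with probability p_i, and L_i = p_i (index_i - 1) / 2.
    Exchanging two adjacent blocks i, j therefore changes the cost by a
    nonnegative prefix probability times p_i p_j (index_i - index_j) / 2
    ([block_value_swap]). Sorting by adjacent exchanges shows that a sorted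
    block policy is optimal; conversely, when the prefix probability is
    positive, an optimal block policy cannot have an adjacent pair in the wrong
    order. *)

Set Implicit Arguments.
Unset Strict Implicit.
Unset Printing Implicit Defensive.
Import Order.TTheory GRing.Theory Num.Theory.
Local Open Scope ring_scope.

(** * Sums over the prefixes of a word *)

Section PrefixSums.
Context {R : nmodType} {V : eqType}.
Implicit Types (F : seq V -> R) (h u : seq V).

(** The history [h] is an argument so that a policy can be cut into pieces, each
    piece being charged for what was drawn before it. *)
Fixpoint prefix_sum F h u : R :=
  if u is j :: u' then F (rcons h j) + prefix_sum F (rcons h j) u' else 0.

Lemma prefix_sum_cat F h u1 u2 :
  prefix_sum F h (u1 ++ u2) = prefix_sum F h u1 + prefix_sum F (h ++ u1) u2.
Proof.
elim: u1 h => [|j u1 IH] h /=; first by rewrite add0r cats0.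
by rewrite IH addrA -cats1 -catA.
Qed.

Lemma prefix_sumE F h u :
  prefix_sum F h u = \sum_(t < size u) F (h ++ take t.+1 u).
Proof.
elim: u h => [|j u IH] h /=; first by rewrite big_ord0.
rewrite big_ord_recl /= take0 cats1 IH; congr (_ + _).
by apply: eq_bigr => t _; rewrite -cats1 -catA.
Qed.

Lemma eq_prefix_sum F F' h h' u :
  (forall s, F (h ++ s) = F' (h' ++ s)) ->
  prefix_sum F h u = prefix_sum F' h' u.
Proof.
by move=> eqF; rewrite !prefix_sumE; apply: eq_bigr => t _; rewrite eqF.
Qed.

End PrefixSums.

(** * Policies as words over the urns *)

Lemma count_nseq_if (T : eqType) (i j : T) n :
  count_mem j (nseq n i) = if i == j then n else 0%N.
Proof. by rewrite count_nseq /=; case: eqP => _; rewrite ?mul1n ?mul0n. Qed.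

Section Policies.
Context {R : realFieldType} {V : finType} (p : V -> R) (N : V -> nat).
Hypothesis p_gt0 : forall i, 0 < p i.
Hypothesis p_le1 : forall i, p i <= 1.
Hypothesis N_gt0 : forall i, (0 < N i)%N.
Implicit Types (i j : V) (h u v x y B : seq V) (rs : seq (V * nat)).

(** The probability that [c] draws from urn [i] are all blue; [c] may exceed
    [N i], where the formula keeps the same slope and goes below [1 - p i]. *)
Definition clean i (c : nat) : R := 1 - p i * (c%:R / (N i)%:R).
Definition all_clean h : R := \prod_i clean i (count_mem i h).
(** Factoring one urn out makes [all_clean] affine in the draws from that urn,
    with a coefficient that these draws leave unchanged. *)
Definition others_clean i h : R := \prod_(j | j != i) clean j (count_mem j h).
Definition policy_cost u : R := prefix_sum all_clean [::] u.

Lemma clean0 i : clean i 0 = 1.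
Proof. by rewrite /clean mul0r mulr0 subr0. Qed.

Lemma clean_full i : clean i (N i) = 1 - p i.
Proof. by rewrite /clean divff ?mulr1 // pnatr_eq0 -lt0n. Qed.

Lemma cleanB i c a : clean i c - clean i (c + a) = a%:R * (p i / (N i)%:R).
Proof. rewrite /clean natrD; ring. Qed.

Lemma slope_gt0 i : 0 < p i / (N i)%:R.
Proof. by rewrite divr_gt0 // ltr0n. Qed.

Lemma clean_anti i : {homo clean i : c c' / (c <= c')%N >-> c' <= c}.
Proof.
move=> c c' le_cc'; rewrite -subr_ge0 -(subnKC le_cc') cleanB.
by rewrite mulr_ge0 // ltW // slope_gt0.
Qed.

Lemma clean_ge0 i c : (c <= N i)%N -> 0 <= clean i c.
Proof. by move=> /(@clean_anti i); apply: le_trans; rewrite clean_full subr_ge0. Qed.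

Lemma all_cleanD i h :
  all_clean h = clean i (count_mem i h) * others_clean i h.
Proof. by rewrite /all_clean (bigD1 i). Qed.

Lemma eq_others_clean i h h' :
  (forall j, j != i -> count_mem j h = count_mem j h') ->
  others_clean i h = others_clean i h'.
Proof. by move=> eqh; apply: eq_bigr => j ji; rewrite eqh. Qed.

Lemma all_clean_perm h h' : perm_eq h h' -> all_clean h = all_clean h'.
Proof. by move=> /permP eqh; apply: eq_bigr => j _; rewrite eqh. Qed.

Lemma others_clean_nseq i h a B :
  others_clean i (h ++ nseq a i ++ B) = others_clean i (h ++ B).
Proof.
apply: eq_others_clean => j ji.
by rewrite !count_cat count_nseq_if eq_sym (negbTE ji).
Qed.

Definition run_cost i c a : R := \sum_(k < a) clean i (c + k.+1).

Lemma prefix_sum_run h i a :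
  prefix_sum all_clean h (nseq a i)
    = run_cost i (count_mem i h) a * others_clean i h.
Proof.
rewrite prefix_sumE size_nseq big_distrl; apply: eq_bigr => k _ /=.
rewrite take_nseq; last exact: ltn_ord.
rewrite (all_cleanD i) -(cats0 (nseq _ _)) others_clean_nseq.
by rewrite !cats0 count_cat count_nseq_if eqxx.

Qed.

Lemma prefix_sum_avoiding h i u : i \notin u ->
  prefix_sum all_clean h u
    = clean i (count_mem i h) * prefix_sum (others_clean i) h u.
Proof.
move=> iu; rewrite !prefix_sumE big_distrr; apply: eq_bigr => t _ /=.
have /count_memPn it : i \notin take t.+1 u by apply: contra iu => /mem_take.
by rewrite (all_cleanD i) count_cat it addn0.
Qed.

Lemma run_cost_cat i c a b :
  run_cost i c (a + b) = run_cost i c a + run_cost i (c + a) b.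
Proof.
rewrite /run_cost big_split_ord /=; congr (_ + _).
by apply: eq_bigr => k _; rewrite -addnS addnA.
Qed.

(** Surviving a draw is the less likely the later the draw is, so the mean
    cost of a draw in the second run is at most its mean cost in the first. *)
Lemma run_cost_average i c a b :
  a%:R * run_cost i (c + a) b <= b%:R * run_cost i c a.
Proof.
apply: (@le_trans _ _ (a%:R * (b%:R * clean i (c + a)))).
  rewrite ler_wpM2l // mulr_natl -[X in _ *+ X]card_ord -sumr_const.
  by apply: ler_sum => k _; apply: clean_anti; rewrite leq_addr.
rewrite mulrCA ler_wpM2l // mulr_natl -[X in _ *+ X]card_ord -sumr_const.
by apply: ler_sum => k _; apply: clean_anti; rewrite leq_add2l.
Qed.

Lemma others_clean_anti i h u : (forall j, (count_mem j (h ++ u) <= N j)%N) ->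
  others_clean i (h ++ u) <= others_clean i h.
Proof.
move=> hN; apply: ler_prod => j _; rewrite clean_ge0 //=.
by apply: clean_anti; rewrite count_cat leq_addr.
Qed.

(** The exchange argument. Let [q = p i / N i], so that [clean i] drops by
    [a * q] and [b * q] along the two runs; let [D] be the drop of
    [others_clean i] along [B], and [sB] the sum of its values there. Delaying
    the first run is harmful only if [run_cost i c a * D < sB * (a * q)],
    advancing the second one only if [sB * (b * q) < run_cost i (c + a) b * D];
    weighting these by [b] and [a] contradicts [run_cost_average]. *)
Lemma merge_runs x i a B b y : i \notin B ->
  (forall j, (count_mem j (x ++ B) <= N j)%N) ->
  policy_cost (x ++ nseq (a + b) i ++ B ++ y)
    <= policy_cost (x ++ nseq a i ++ B ++ nseq b i ++ y) \/
  policy_cost (x ++ B ++ nseq (a + b) i ++ y)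
    <= policy_cost (x ++ nseq a i ++ B ++ nseq b i ++ y).
Proof.
move=> iB xBN; pose c := count_mem i x.
pose D := others_clean i x - others_clean i (x ++ B).
pose sB := prefix_sum (others_clean i) x B.
have D_ge0 : 0 <= D by rewrite subr_ge0 others_clean_anti.
have count_xB : count_mem i (x ++ B) = c by rewrite count_cat (count_memPn iB) addn0.
have run_xB n : prefix_sum all_clean (x ++ B) (nseq n i)
    = run_cost i c n * others_clean i (x ++ B).
  by rewrite prefix_sum_run count_xB.
have run_after m n : prefix_sum all_clean (x ++ nseq m i ++ B) (nseq n i)
    = run_cost i (c + m) n * others_clean i (x ++ B).
  rewrite prefix_sum_run others_clean_nseq !count_cat count_nseq_if eqxx.
  by rewrite (count_memPn iB) addn0.
have avoid_after m : prefix_sum all_clean (x ++ nseq m i) B = clean i (c + m) * sB.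
  rewrite (prefix_sum_avoiding _ iB) count_cat count_nseq_if eqxx; congr (_ * _).
  by apply: eq_prefix_sum => s; rewrite -catA others_clean_nseq.
have tail h : perm_eq h (x ++ nseq (a + b) i ++ B) -> prefix_sum all_clean h y
    = prefix_sum all_clean (x ++ nseq (a + b) i ++ B) y.
  by move=> hE; apply: eq_prefix_sum => s; apply: all_clean_perm; rewrite perm_cat2r.
have swap1 : policy_cost (x ++ nseq a i ++ B ++ nseq b i ++ y)
    - policy_cost (x ++ nseq (a + b) i ++ B ++ y)
      = sB * (b%:R * (p i / (N i)%:R)) - run_cost i (c + a) b * D.
  rewrite /policy_cost !prefix_sum_cat /= !(prefix_sum_run x).
  rewrite -!catA run_after !avoid_after run_cost_cat tail; last first.
    by rewrite perm_cat2l nseqD -!catA perm_cat2l perm_catC.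
  by rewrite -(cleanB _ (c + a)) -addnA /D; ring.
have swap2 : policy_cost (x ++ nseq a i ++ B ++ nseq b i ++ y)
    - policy_cost (x ++ B ++ nseq (a + b) i ++ y)
      = run_cost i c a * D - sB * (a%:R * (p i / (N i)%:R)).
  rewrite /policy_cost !prefix_sum_cat /= run_xB prefix_sum_run.
  rewrite -!catA run_after !avoid_after run_cost_cat tail; last first.
    by rewrite perm_cat2l nseqD -!catA perm_cat2l perm_catC.
  rewrite tail; last by rewrite perm_cat2l perm_catC.
  by rewrite (prefix_sum_avoiding _ iB) -(cleanB _ c) /D -/c -/sB; ring.
have [->|b_gt0] := posnP b; first by left; rewrite addn0.
have [le1|lt1] := leP 0 (sB * (b%:R * (p i / (N i)%:R)) - run_cost i (c + a) b * D).
  by left; rewrite -subr_ge0 swap1.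
have [le2|lt2] := leP 0 (run_cost i c a * D - sB * (a%:R * (p i / (N i)%:R))).
  by right; rewrite -subr_ge0 swap2.
(* Multiplied by [a] and [b], the two strict inequalities meet in the middle
   term [a * b * q * sB]; strictness survives because [b] is positive. *)
have avg := ler_wpM2r D_ge0 (run_cost_average i c a b).
have le1 := ler_wpM2l (ler0n R a) (ltW lt1).
have lt2b : b%:R * (run_cost i c a * D) < b%:R * (sB * (a%:R * (p i / (N i)%:R))).
  by rewrite ltr_pM2l ?ltr0n // -subr_lt0.
by set q := p i / _ in lt2b le1; lra.
Qed.

(** * Reduction to block policies *)

Definition expand rs : seq V := flatten [seq nseq r.2 r.1 | r <- rs].
Definition blocks v : seq V := flatten [seq nseq (N i) i | i <- v].

Lemma expand_cat rs1 rs2 : expand (rs1 ++ rs2) = expand rs1 ++ expand rs2.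
Proof. by rewrite /expand map_cat flatten_cat. Qed.

Lemma notin_expand i rs : i \notin map fst rs -> i \notin expand rs.
Proof.
apply: contra => /flatten_mapP[r r_rs]; rewrite mem_nseq => /andP[_ /eqP ->].
exact: map_f.
Qed.

Lemma first_repetition rs : ~~ uniq (map fst rs) ->
  exists (x : seq (V * nat)) i a (B : seq (V * nat)) b (y : seq (V * nat)),
    rs = x ++ (i, a) :: B ++ (i, b) :: y /\ i \notin map fst B.
Proof.
elim: rs => //= -[i a] rs IH; rewrite negb_and negbK /=.
case: (boolP (i \in map fst rs)) => [i_rs _|_ /= /IH]; last first.
  by move=> [x [j [b [B [c [y [-> jB]]]]]]]; exists ((i, a) :: x), j, b, B, c, y.
have /split_find : has (fun r => r.1 == i) rs.
  by case/mapP: i_rs => r r_rs ->; apply/hasP; exists r.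
case=> -[j b] B y /= /eqP -> noB; exists [::], i, a, B, b, y; split.
  by rewrite cat_rcons.
apply: contra noB => /mapP[r r_B ->]; by apply/hasP; exists r.
Qed.

Lemma count_expand rs i a : uniq (map fst rs) -> (i, a) \in rs ->
  count_mem i (expand rs) = a.
Proof.
elim: rs => //= -[j b] rs IH /andP[j_rs u_rs]; rewrite count_cat count_nseq_if /=.
rewrite in_cons => /orP[/eqP[-> ->]|i_rs].
  by rewrite eqxx (count_memPn (notin_expand j_rs)) addn0.
rewrite IH //; case: eqP => // ji; case/negP: j_rs.
by rewrite ji; apply: (map_f fst i_rs).
Qed.

(** Merging decreases the number of runs, and a list of runs in which no urn
    is repeated is a block policy. *)
Lemma exists_blocks_le rs : (forall j, count_mem j (expand rs) = N j) ->
  exists2 v, perm_eq v (enum V) & policy_cost (blocks v) <= policy_cost (expand rs).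
Proof.
have [n] := ubnP (size rs); elim: n rs => // n IH rs /ltnSE size_rs rsN.
have [u_rs|/first_repetition] := boolP (uniq (map fst rs)).
  exists (map fst rs).
    apply: uniq_perm => //; first exact: enum_uniq.
    move=> i; rewrite mem_enum; apply: contraTT (N_gt0 i) => i_rs.
    by rewrite -rsN (count_memPn (notin_expand i_rs)).
  rewrite /blocks -map_comp (_ : map _ rs = [seq nseq r.2 r.1 | r <- rs]) //.
  by apply/eq_in_map => -[i a] /= i_rs; rewrite -rsN (count_expand u_rs i_rs).
move=> [x [i [a [B [b [y [rsE iB]]]]]]].
have expandE : expand rs = expand x ++ nseq a i ++ expand B ++ nseq b i ++ expand y.
  by rewrite rsE expand_cat /= /expand /= -/(expand _) -/(expand _) expand_cat.
have shorter rs' : perm_eq (expand rs') (expand rs) ->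
    (size rs' < size rs)%N -> policy_cost (expand rs') <= policy_cost (expand rs) ->
    exists2 v, perm_eq v (enum V) & policy_cost (blocks v) <= policy_cost (expand rs).
  move=> /permP rs'E size_rs' le_rs'; have [||v v_perm v_le] := IH rs'.
  - exact: leq_trans size_rs' size_rs.
  - by move=> j; rewrite rs'E.
  by exists v => //; apply: le_trans le_rs'.
have xBN j : (count_mem j (expand x ++ expand B) <= N j)%N.
  by rewrite -rsN expandE !count_cat; lia.
case: (merge_runs a b (expand y) (notin_expand iB) xBN) => le_cost.
- apply: (shorter (x ++ (i, (a + b)%N) :: B ++ y)).
  + rewrite expandE !expand_cat /= /expand /= -!/(expand _) expand_cat perm_cat2l.
    by rewrite nseqD -!catA perm_cat2l !catA perm_cat2r perm_catC.
  + by rewrite rsE !size_cat /= !size_cat /=; lia.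
  + by move: le_cost; rewrite expandE !expand_cat /= /expand /= -!/(expand _) expand_cat.
- apply: (shorter (x ++ B ++ (i, (a + b)%N) :: y)).
  + rewrite expandE !expand_cat perm_cat2l /expand /= -!/(expand _).
    by rewrite nseqD !catA !perm_cat2r perm_catC.
  + by rewrite rsE !size_cat /= !size_cat /=; lia.
  + by move: le_cost; rewrite expandE !expand_cat.
Qed.

Lemma exists_block_policy_le u : (forall j, count_mem j u = N j) ->
  exists2 v, perm_eq v (enum V) & policy_cost (blocks v) <= policy_cost u.
Proof.
suff -> : u = expand [seq (i, 1%N) | i <- u] by apply: exists_blocks_le.
by rewrite /expand -map_comp /comp /= flatten_map1 map_id.
Qed.

(** * Block policies and the exchange of adjacent blocks *)

(** The cost of a block policy as a recursion on the order of the urns: what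
    comes after the first urn is reached only if that urn is all blue. *)
Definition block_value v : R :=
  foldr (fun i s => run_cost i 0 (N i) + (1 - p i) * s) 0 v.

Lemma prefix_sum_blocks h v : uniq v -> (forall j, j \in v -> j \notin h) ->
  prefix_sum all_clean h (blocks v) = all_clean h * block_value v.
Proof.
elim: v h => [|i v IH] h /=; first by rewrite mulr0.
move=> /andP[i_v u_v] vh; have i_h := vh i (mem_head _ _).
rewrite prefix_sum_cat prefix_sum_run (all_cleanD i h) (count_memPn i_h) clean0.
rewrite IH // => [|j j_v]; last first.
  rewrite mem_cat negb_or vh ?in_cons ?j_v ?orbT //= mem_nseq negb_and.
  by rewrite (memPn i_v) ?orbT.
rewrite (all_cleanD i (_ ++ _)) -(cats0 (nseq _ _)) others_clean_nseq !cats0.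
rewrite count_cat count_nseq_if eqxx (count_memPn i_h) clean_full; ring.
Qed.

Lemma policy_cost_blocks v : uniq v -> policy_cost (blocks v) = block_value v.
Proof.
move=> u_v; rewrite /policy_cost prefix_sum_blocks // /all_clean big1 ?mul1r // => i _.
exact: clean0.
Qed.

Definition block_index i : R := (N i)%:R * ((2 - p i) / p i).

(** Where the index comes from: up to an increasing affine map it is the ratio
    between the cost of a block and its probability of ending the search. *)
Lemma run_cost_full i : run_cost i 0 (N i) = p i * ((block_index i - 1) / 2).
Proof.
have Nn0 : (N i)%:R != 0 :> R by rewrite pnatr_eq0 -lt0n.
have pn0 : p i != 0 by rewrite gt_eqF.
have runE a : run_cost i 0 a = a%:R - p i / (N i)%:R * (a%:R * (a%:R + 1) / 2).
  elim: a => [|a IH]; first by rewrite /run_cost big_ord0; ring.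
  rewrite -addn1 run_cost_cat IH /run_cost big_ord_recl big_ord0 /= /clean /bump.
  by rewrite !natrD; field.
by rewrite runE /block_index; field; rewrite Nn0 pn0.
Qed.

Lemma block_value_swap x i j y :
  block_value (x ++ i :: j :: y) - block_value (x ++ j :: i :: y)
    = (\prod_(k <- x) (1 - p k)) * (p i * p j / 2 * (block_index i - block_index j)).
Proof.
elim: x => [|k x IH] /=.
  by rewrite big_nil !run_cost_full; ring.
rewrite big_cons -mulrA -IH; ring.
Qed.

Lemma block_value_swap_le x i j y : block_index i <= block_index j ->
  block_value (x ++ i :: j :: y) <= block_value (x ++ j :: i :: y).
Proof.
move=> ij; rewrite -subr_le0 block_value_swap mulr_ge0_le0 //.
  by apply: prodr_ge0 => k _; rewrite subr_ge0.
by rewrite mulr_ge0_le0 ?subr_le0 // divr_ge0 // mulr_ge0 // ltW.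
Qed.

(** In any other order, the urn of least index can be moved to the front by
    exchanges that do not increase the cost; the rest follows by induction. *)
Lemma sorted_block_value_le v w :
  sorted (fun i j => block_index i <= block_index j) v -> perm_eq v w ->
  block_value v <= block_value w.
Proof.
have index_trans : transitive (fun i j => block_index i <= block_index j).
  by move=> j i k; apply: le_trans.
elim: v w => [|i v IH] w v_sorted vw; first by move: vw; rewrite perm_sym => /perm_nilP ->.
have /splitPr wE : i \in w by rewrite -(perm_mem vw) mem_head.
case: wE vw => w1 w2 vw.
have {}vw : perm_eq v (w1 ++ w2).
  by move: vw; rewrite perm_sym -(cat1s i w2) perm_catCA /= perm_cons perm_sym.
have i_min j : j \in w1 -> block_index i <= block_index j.
  move=> j_w1; have /allP := order_path_min index_trans v_sorted; apply.
  by rewrite (perm_mem vw) mem_cat j_w1.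
apply: (@le_trans _ _ (block_value (i :: w1 ++ w2))).
  by rewrite /= lerD2l ler_wpM2l ?subr_ge0 // IH // (path_sorted v_sorted).
elim/last_ind: w1 w2 i_min {vw} => [|w1 j IHw] w2 i_min //.
rewrite cat_rcons; apply: (@le_trans _ _ (block_value (w1 ++ i :: j :: w2))).
  by apply: IHw => k k_w1; apply: i_min; rewrite mem_rcons in_cons k_w1 orbT.
by rewrite cat_rcons; apply: block_value_swap_le; apply: i_min; rewrite mem_rcons mem_head.
Qed.

(** An exchange is felt only if the search can get past the prefix, hence the
    condition on the urns in [x]. *)
Lemma swap_le_index x i j y : (forall k, k \in x -> p k < 1) ->
  block_value (x ++ i :: j :: y) <= block_value (x ++ j :: i :: y) ->
  block_index i <= block_index j.
Proof.
move=> x_lt1; rewrite -subr_le0 block_value_swap.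
rewrite pmulr_rle0; last first.
  rewrite big_seq; apply: prodr_gt0 => k k_x; by rewrite subr_gt0 x_lt1.
by rewrite pmulr_rle0 ?subr_le0 // divr_gt0 // mulr_gt0.
Qed.

End Policies.

(** * The expected cost as a sum over prefixes *)

Section ExpectedCost.
Local Open Scope classical_set_scope.

Lemma probability_finite_partition d (T : measurableType d) (R : realType)
    (mu : probability T R) (I : finType) (f : T -> I) (E : set T) :
  (forall i, measurable (E `&` [set w | f w = i])) ->
  mu E = (\sum_i mu (E `&` [set w | f w = i]))%E.
Proof.
move=> mE; have -> : mu E = mu (\bigcup_(i in [set: I]) (E `&` [set w | f w = i])).
  congr (mu _); apply/seteqP; split=> [w Ew|w [i _ []] //].
  by exists (f w).
rewrite measure_fin_bigcup //; last first.
- apply/trivIsetP => i j _ _ /eqP ij; apply/seteqP; split=> // w [[_ fi] [_ fj]].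
  by apply: ij; rewrite -fi -fj.
- exact: finite_finset.
rewrite [RHS]fsbig_seq ?index_enum_uniq //; apply: eq_fsbigl.
by apply/seteqP; split=> i //= _; rewrite mem_index_enum.
Qed.

Lemma card_ord_interval m a b : (b <= m)%N ->
  #|[pred k : 'I_m.+1 | (a < k <= b)%N]| = (b - a)%N.
Proof.
move=> le_bm; have -> : (b - a = \sum_(a.+1 <= k < b.+1) 1)%N.
  by rewrite sum_nat_const_nat muln1 subSS.
rewrite (big_nat_widenl _ 0) // (big_nat_widen _ _ m.+1) // big_mkord -sum1_card.
by apply: eq_bigl => k; rewrite inE.
Qed.

Section Event.
Context {d : measure_display} {T : measurableType d} {R : realType}.
Context {P : probability T R} {V : finType} (S : @urn_problem d T R P V).
Let N := urn_size S.
Let p i := phi S [set i].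
Implicit Types (i : V) (U : {set V}) (w : T) (u s : seq V).

Lemma measurable_forall (E : V -> set T) :
  (forall i, measurable (E i)) -> measurable [set w | forall i, E i w].
Proof.
move=> mE; rewrite (_ : mkset _ = \bigcap_(i in [set: V]) E i).
  by apply: fin_bigcap_measurable.
by apply/seteqP; split=> [w Ew i _|w Ew i]; apply: Ew.
Qed.

Lemma measurable_forall_in (A : pred V) (E : V -> set T) :
  (forall i, measurable (E i)) -> measurable [set w | forall i, A i -> E i w].
Proof.
move=> mE; apply: (measurable_forall (E := fun i => [set w | A i -> E i w])) => i.
case: (A i).
  rewrite (_ : mkset _ = E i) //.
  by apply/seteqP; split=> w /= Ew; first exact: Ew.
by rewrite (_ : mkset _ = setT) //; apply/seteqP; split.
Qed.

Lemma measurable_exactly_red U : measurable (exactly_red (red S) U).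
Proof.
apply: (measurable_forall (E := fun i => [set w | red S i w <-> i \in U])) => i.
case: (i \in U).
  rewrite (_ : mkset _ = red S i); first exact: measurable_red.
  by apply/seteqP; split=> w /=; [case=> _; apply | split].
rewrite (_ : mkset _ = ~` red S i).
  by apply: measurableC; apply: measurable_red.
by apply/seteqP; split=> w /=; [case=> redU _ /redU | move=> nred; split=> // /nred].
Qed.

Lemma measurable_red_pos i (D : set nat) :
  measurable (red S i `&` [set w | D (pos S i w)]).
Proof. exact: (measurable_pos (u := S) (i := i) (measurable_red S i) (Y := D)). Qed.

Lemma measurable_red_bigcap U : measurable (\bigcap_(i in [set` U]) red S i).
Proof.
by apply: fin_bigcap_measurable => // i _; apply: measurable_red.
Qed.

Lemma phiE U : (phi S U)%:E = P (\bigcap_(i in [set` U]) red S i).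
Proof. by rewrite fineK // fin_num_measure //; apply: measurable_red_bigcap. Qed.

Lemma phi_gt0 i : 0 < p i.
Proof.
rewrite -lte_fin phiE (_ : bigcap _ _ = red S i); first exact: red_gt0.
by apply/seteqP; split=> [w|w rw j /=]; [apply; rewrite /= inE | rewrite inE => /eqP ->].
Qed.

Lemma phi_le1 U : phi S U <= 1.
Proof.
by rewrite -lee_fin phiE probability_le1 //; apply: measurable_red_bigcap.
Qed.

Hypothesis S_indep : independent_urns S.

(** Independence speaks only of the events that urns do contain a red marble;
    it passes to the complements one urn at a time, from
    P(E and not A_j) = P(E) - P(E and A_j). *)
Lemma prob_red_clean U s : uniq s -> (forall j, j \in s -> j \notin U) ->
  P [set w | (forall i, i \in U -> red S i w) /\ (forall i, i \in s -> ~ red S i w)]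
    = (\prod_(i in U) p i * \prod_(i <- s) (1 - p i))%:E.
Proof.
elim: s U => [|j s IH] U /=.
  move=> _ _; rewrite big_nil mulr1 -S_indep phiE.
  by congr (P _); apply/seteqP; split=> w; [case=> + _|move=> ?; split].
move=> /andP[js us] sU; have jU : j \notin U by apply: sU; rewrite mem_head.
have mj := measurable_red S j.
pose E := [set w | (forall i, i \in U -> red S i w) /\ (forall i, i \in s -> ~ red S i w)].
have mE : measurable E.
  apply: measurableI; apply: measurable_forall_in => i; first exact: measurable_red.
  by apply: measurableC; apply: measurable_red.
have PE : P E = (\prod_(i in U) p i * \prod_(i <- s) (1 - p i))%:E.
  by apply: IH => // i i_s; apply: sU; rewrite in_cons i_s orbT.
have := IH (j |: U) us; rewrite (_ : mkset _ = E `&` red S j); last first.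
  apply/seteqP; split=> w /=.
    move=> [redU reds]; split; last by apply: redU; rewrite setU11.
    by split=> // i iU; apply: redU; rewrite inE iU orbT.
  move=> [[redU reds] redj]; split=> // i; rewrite !inE => /orP[/eqP -> //|].
  exact: redU.
move=> PEj; rewrite (_ : mkset _ = E `\` red S j); last first.
  apply/seteqP; split=> w /=.
    move=> [redU reds]; split; last by apply: reds; rewrite mem_head.
    by split=> // i i_s; apply: reds; rewrite in_cons i_s orbT.
  move=> [[redU reds] redj]; split=> // i; rewrite in_cons => /orP[/eqP -> //|].
  exact: reds.
rewrite measureD //; last first.
  by move: PE => /= ->; rewrite ltry.
rewrite [X in (X - _)%E]PE [X in (_ - X)%E]PEj.
  by rewrite -EFinB big_setU1 //= big_cons; congr EFin; ring.
move=> i i_s; rewrite !inE negb_or sU ?in_cons ?i_s ?orbT // andbT.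
by apply: contraNneq js => <-.
Qed.

Lemma prob_exactly_red U :
  P (exactly_red (red S) U) = (\prod_i (if i \in U then p i else 1 - p i))%:E.
Proof.
rewrite (_ : exactly_red _ _ = [set w | (forall i, i \in U -> red S i w) /\
    (forall i, i \in enum (~: U) -> ~ red S i w)]); last first.
  apply/seteqP; split=> w /=.
    move=> wU; split=> i; first by move/wU.
    by rewrite mem_enum inE => iU /wU; rewrite (negbTE iU).
  move=> [redU cleanU] i; split=> [redi|/redU //].
  by apply: contraPT redi => iU; apply: cleanU; rewrite mem_enum inE.
rewrite prob_red_clean ?enum_uniq // => [|j]; last by rewrite mem_enum inE.
congr EFin; rewrite [RHS](bigID (mem U)) /= big_enum /=; congr (_ * _).
  by apply: eq_bigr => i ->.
by apply: eq_big => [i|i]; rewrite inE // => /negbTE ->.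
Qed.

(** The event that the first [c i] draws from every urn [i] are blue. *)
Definition clean_event (c : V -> nat) : set T :=
  [set w | forall i, red S i w -> (c i < pos S i w)%N].

Lemma measurable_clean_event c : measurable (clean_event c).
Proof.
apply: (measurable_forall (E := fun i => [set w | red S i w -> (c i < pos S i w)%N])) => i.
rewrite (_ : mkset _ = ~` (red S i `&` [set w | (pos S i w <= c i)%N])).
  apply: measurableC; exact: (measurable_red_pos i [set k | (k <= c i)%N]).
apply/seteqP; split=> w /=; first by move=> lt_c [/lt_c]; rewrite ltnNge => /negP.
by move=> nle redi; rewrite ltnNge; apply/negP => le; apply: nle.
Qed.

(** Given the set of red urns, the positions are uniform and independent: the
    probability sums the law of the positions over the box of positions beyond
    [c], which is a product of intervals. *)
Lemma prob_clean_event_exactly_red c U : (forall i, (c i <= N i)%N) ->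
  P (clean_event c `&` exactly_red (red S) U)
    = (\prod_i (if i \in U then p i * (1 - (c i)%:R / (N i)%:R) else 1 - p i))%:E.
Proof.
move=> cN; pose M := \max_i N i.
have leM i k : (k <= N i)%N -> (k < M.+1)%N.
  by move=> kN; rewrite ltnS (leq_trans kN) // (leq_bigmax (F := N)).
(* Set to [ord0] outside [U], where the positions are unconstrained. *)
pose position w : {ffun V -> 'I_M.+1} :=
  [ffun i => if i \in U then inord (pos S i w) else ord0].
pose Q i : pred 'I_M.+1 := [pred k : 'I_M.+1 | (c i < k <= N i)%N].
have atE k : clean_event c `&` exactly_red (red S) U `&` [set w | position w = k]
    = if k \in pfamily ord0 (mem U) Q
      then [set w | exactly_red (red S) U w /\
                    forall i, i \in U -> pos S i w = k i] else set0.
  have posE i w : red S i w -> i \in U -> position w i = pos S i w :> nat.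
    move=> redi iU; rewrite ffunE iU inordK // (leM i) //.
    by case/andP: (pos_range redi).
  apply/seteqP; split=> [w [[/= blue ex] <-]|w].
    rewrite ifT; first by (split=> // i iU; rewrite posE //; apply/ex).
    apply/pfamilyP; split=> [|i iU].
      by apply/supportP => i iU; rewrite ffunE (negbTE iU).
    have redi : red S i w by apply/ex.
    by rewrite inE posE // blue //=; case/andP: (pos_range redi).
  case: ifP => // /pfamilyP[/supportP k0 kQ] /= [ex posk]; split.
    by split=> // i /ex iU; rewrite posk //; case/andP: (kQ i iU).
  apply/ffunP => i; rewrite ffunE; case: ifP => iU; last by rewrite k0 ?iU.
  by rewrite posk // inord_val.
have measurable_at k : measurable [set w | exactly_red (red S) U w /\
    forall i, i \in U -> pos S i w = k i].
  rewrite (_ : mkset _ = exactly_red (red S) U `&` [set w | forall i, i \in U ->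
      (red S i `&` [set w | pos S i w = k i]) w]).
    apply: measurableI; first exact: measurable_exactly_red.
    apply: measurable_forall_in => i.
    exact: (measurable_red_pos i [set m | m = k i]).
  apply/seteqP; split=> w [ex posk]; split=> // i iU.
    by split; [apply/ex | apply: posk].
  by case: (posk i iU).
rewrite (probability_finite_partition P (f := position)) => [|k]; last first.
  by rewrite atE; case: ifP.
rewrite (eq_bigr (fun k : {ffun V -> 'I_M.+1} => if k \in pfamily ord0 (mem U) Q then
    ((\prod_i (if i \in U then p i else 1 - p i))
      * \prod_(i in U) (N i)%:R^-1)%:E else 0%E)); last first.
  move=> k _; rewrite atE; case: ifP => [/pfamilyP[_ kQ]|_]; last exact: measure0.
  have pos_lawk := @pos_law _ _ _ _ _ S U (fun i => k i).
  rewrite EFinM -prob_exactly_red; apply: pos_lawk => i /kQ.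
  by case/andP=> ck ->; rewrite andbT (leq_ltn_trans _ ck).
rewrite -big_mkcond /= sumEFin -mulr_sumr; congr EFin.
have -> : \sum_(k in pfamily ord0 (mem U) Q) \prod_(i in U) (N i)%:R^-1
    = \prod_(i in U) (1 - (c i)%:R / (N i)%:R) :> R.
  rewrite -(big_distr_big_dep ord0 (mem U) Q (fun i _ => (N i)%:R^-1)).
  apply: eq_bigr => i _; rewrite sumr_const.
  have -> : #|Q i| = (N i - c i)%N by rewrite card_ord_interval // -ltnS (leM i).
  rewrite -[LHS]mulr_natr natrB // mulrBr mulVf ?pnatr_eq0 -?lt0n ?urn_size_gt0 //.
  by rewrite [_^-1 * _]mulrC.
rewrite [\prod_(i in U) _]big_mkcond -big_split; apply: eq_bigr => i _ /=.
by case: ifP => _; rewrite ?mulr1.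
Qed.

(** Summing over the sets of red urns expands the product of the
    p_i (1 - c_i / N_i) + (1 - p_i), which are the [clean i (c i)]. *)
Lemma prob_clean_event c : (forall i, (c i <= N i)%N) ->
  P (clean_event c) = (\prod_i clean p N i (c i))%:E.
Proof.
move=> cN; pose redset w := [set i | `[< red S i w >]]%SET.
have redsetE U : [set w | redset w = U] = exactly_red (red S) U.
  apply/seteqP; split=> w /=.
    by move=> <- i; rewrite inE; split=> /asboolP.
  by move=> ex; apply/setP => i; rewrite inE; apply/asboolP/idP => /ex.
rewrite (probability_finite_partition P (f := redset)) => [|U]; last first.
  rewrite redsetE; apply: measurableI; first exact: measurable_clean_event.
  exact: measurable_exactly_red.
rewrite (eq_bigr (fun U : {set V} =>
    (\prod_i (if i \in U then p i * (1 - (c i)%:R / (N i)%:R) else 1 - p i))%:E));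
  last by move=> U _; rewrite redsetE prob_clean_event_exactly_red.
rewrite sumEFin; congr EFin.
rewrite (eq_bigr (fun i => p i * (1 - (c i)%:R / (N i)%:R) + (1 - p i))); last first.
  by move=> i _; rewrite /clean; ring.
by rewrite bigA_distr.
Qed.

(** Prefix counts grow by at most one, hence take all intermediate values. *)
Lemma count_take_surj u i k n : (0 < k <= count_mem i (take n u))%N ->
  exists m, [/\ (m < n)%N, (m < size u)%N, nth i u m = i
                & count_mem i (take m.+1 u) = k].
Proof.
elim: n => [|n IH]; first by rewrite take0 /= leqn0 => /andP[/lt0n_neq0/negbTE ->].
move=> /andP[k_gt0]; have [le_un|lt_nu] := leqP (size u) n.
  rewrite !take_oversize // ?(leqW le_un) // => le_k.
  have [|m [lt_mn lt_mu nthm countm]] := IH; first by rewrite k_gt0 take_oversize.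
  by exists m; split => //; apply: ltnW.
rewrite (take_nth i) // -cats1 count_cat /= addn0.
have [le_k _|lt_k le_k] := leqP k (count_mem i (take n u)).
  have [|m [lt_mn lt_mu nthm countm]] := IH; first by rewrite k_gt0.
  by exists m; split => //; apply: ltnW.
have nthn : nth i u n == i.
  by apply: contraTT le_k => /negbTE ->; rewrite addn0 -ltnNge.
exists n; split=> //; first exact/eqP.
rewrite (take_nth i) // -cats1 count_cat /= addn0; move: le_k; rewrite nthn addn1.
by move=> le_k; apply/eqP; rewrite eqn_leq lt_k.
Qed.

(** The red marble of an urn has been met exactly when as many draws as its
    position were made from that urn. *)
Lemma blue_drawnE u w (t : 'I_(size u)) :
  reflect (clean_event (fun i => count_mem i (take t.+1 u)) w) (blue_drawn S w t).
Proof.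
apply: (iffP forallP) => [blue i redi|blue s].
  rewrite ltnNge; apply/negP => le_pos.
  have /andP[pos_gt0 _] := pos_range redi.
  have [|m [lt_mt lt_mu nthm countm]] := @count_take_surj u i (pos S i w) t.+1.
    by rewrite pos_gt0.
  have := blue (Ordinal lt_mu); rewrite -ltnS lt_mt /=.
  have urnm : urn_at (Ordinal lt_mu) = i by rewrite /urn_at (tnth_nth i).
  by rewrite /red_at urnm countm eqxx andbT => /asboolP.
apply/implyP => le_st; apply/negP => /andP[/asboolP /blue lt_pos /eqP pos_s].
move: lt_pos; rewrite pos_s ltnNge => /negP; apply.
by rewrite -(take_takel u (_ : s.+1 <= t.+1)%N) // leq_count_subseq // take_subseq.
Qed.

Lemma expected_costE u : (forall i, (count_mem i u <= N i)%N) ->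
  expected_cost S u = (policy_cost p N u)%:E.
Proof.
move=> uN; rewrite /expected_cost unlock /=.
pose B (t : 'I_(size u)) := clean_event (fun i => count_mem i (take t.+1 u)).
have mB t : measurable (B t) by apply: measurable_clean_event.
transitivity (\int[P]_w (\sum_(t < size u) (\1_(B t) w)%:E))%E.
  apply: eq_integral => w _; rewrite sumEFin /cost -sum1_card natr_sum big_mkcond.
  congr EFin; apply: eq_bigr => t _; rewrite indicE inE.
  by have [/= Bw|nBw] := blue_drawnE w t; [rewrite mem_set|rewrite memNset].
rewrite ge0_integral_sum //; last first.
  move=> t; apply/measurable_realfun.measurable_EFinP.
  exact: measurable_realfun.measurable_indic.
rewrite /policy_cost prefix_sumE -sumEFin; apply: eq_bigr => t _.
rewrite integral_indic // setIT; apply: prob_clean_event => i.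
by rewrite (leq_trans _ (uN i)) // leq_count_subseq // take_subseq.
Qed.

End Event.

End ExpectedCost.

(** * Optimality of block policies *)

Lemma valid_block_policy d (T : measurableType d) (R : realType)
    (P : probability T R) (V : finType) (S : @urn_problem d T R P V) v :
  urn_ordering v -> valid_policy S (block_policy S v).
Proof.
move=> v_ord; split=> [|i].
  rewrite size_flatten /shape -map_comp sumnE big_map -big_enum /= (perm_big _ v_ord).
  by apply: eq_bigr => i _; rewrite /= size_nseq.
rewrite /block_policy count_flatten -map_comp sumnE big_map (perm_big _ v_ord) /=.
rewrite big_enum (bigD1 i) //= count_nseq_if eqxx big1 ?addn0 // => j ji.
by rewrite count_nseq_if (negbTE ji).
Qed.

(* Without the hypothesis phi_i < 1 the "only if" part fails: the urns placed
   after one that surely contains a red marble are never queried, so they can be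
   reordered freely. The hypothesis is asked only of the urns that precede at
   least two others, since no reordering is possible after the remaining ones. *)
Theorem theorem4 (d : measure_display) (T : measurableType d) (R : realType)
    (P : probability T R) (V : finType) (V_gt0 : (0 < #|V|)%N)
    (S : @urn_problem d T R P V) (S_indep : independent_urns S)
    (v : seq V) (v_ordering : urn_ordering v) :
  (sorted (fun i j => urn_index S i <= urn_index S j) v ->
     optimal S (block_policy S v)) /\
  ((forall i, i \in take (#|V| - 2) v -> phi S [set i] < 1) ->
     optimal S (block_policy S v) ->
     sorted (fun i j => urn_index S i <= urn_index S j) v).
Proof.
pose p i := phi S [set i]; pose N := urn_size S.
have p_gt0 i : 0 < p i by apply: phi_gt0.
have p_le1 i : p i <= 1 by apply: phi_le1.
have N_gt0 i : (0 < N i)%N by apply: urn_size_gt0.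
have costE u : valid_policy S u -> expected_cost S u = (policy_cost p N u)%:E.
  by move=> [_ uN]; apply: expected_costE => // i; rewrite uN.
have block_costE w : urn_ordering w ->
    expected_cost S (block_policy S w) = (block_value p N w)%:E.
  move=> w_ord; rewrite costE; last exact: valid_block_policy.
  by rewrite policy_cost_blocks // (perm_uniq w_ord) enum_uniq.
split=> [v_sorted|lt1 [_ v_opt]].
  split=> [|u u_valid]; first exact: valid_block_policy.
  rewrite block_costE // costE // lee_fin.
  have [w w_ord le_wu] := exists_block_policy_le p_gt0 p_le1 N_gt0 (proj2 u_valid).
  apply: le_trans le_wu; rewrite policy_cost_blocks //; last first.
    by rewrite (perm_uniq w_ord) enum_uniq.
  apply: sorted_block_value_le => //.
  by rewrite perm_sym (perm_trans w_ord) // perm_sym.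
have index_le x i j y : v = x ++ i :: j :: y -> urn_index S i <= urn_index S j.
  move=> vE; apply: (@swap_le_index _ _ p N p_gt0 N_gt0 x i j y).
    move=> k k_x; apply: lt1; rewrite cardE -(perm_size v_ordering) vE size_cat /=.
    (* [x] precedes [i], [j] and [y], so it lies in the first #|V| - 2 urns. *)
    by rewrite !addnS subn2 /= take_cat ltnNge leq_addr /= mem_cat k_x.
  have w_ord : urn_ordering (x ++ j :: i :: y).
    apply: perm_trans v_ordering; rewrite vE perm_cat2l.
    by rewrite -(cat1s j) -(cat1s i) perm_catCA.
  have := v_opt _ (valid_block_policy S w_ord).
  by rewrite !block_costE // lee_fin vE.
suff sorted_tail x y : v = x ++ y -> sorted (fun i j => urn_index S i <= urn_index S j) y.
  by apply: (sorted_tail [::]).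
elim: y x => // i [//|j y] IH x vE /=; rewrite (index_le _ _ _ _ vE).
by apply: (IH (rcons x i)); rewrite cat_rcons.
Qed.
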